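(* Let $\mathbf{p}=(p_i)_{i\ge1}$ with $p_1=0$, $p_2=1$, $p_i\in(0,1)$ for $i\ge 3$, let $q_i=1-p_i$, and let $C_j(n)$ be the number of cycles of size $j$ of the random derangement process $X^{n,\mathbf{p}}$. For $1<j\le n$, $$\mathbb{E}_{\mathbf{p}}(C_{j}(n))=q_{n-j+1}\prod_{l=n-j+2}^{n-1}p_l+\sum_{i=j+1}^{n-1}\sum_{k=0}^{n-i-1}(-1)^kq_{i-j}\prod_{l=i-j+1}^{i-2}p_l\prod_{l=i}^{k+i}q_l.$$ Furthermore, if there exists a constant $\alpha\ge 0$ such that $\lim_{n\to\infty}nq_n=\alpha$, then for any $j>1$ and any $m\ge 1$, $$\lim_{n\to\infty}\mathbb{E}_{\mathbf{p}}(C_j(n))=\sum_{k=0}^{2m-1}(-1)^{k}\bar b_k(j)+\varepsilon(m,\mathbf{p},j),$$ with $\varepsilon(m,\mathbf{p},j)\le\bar b_{2m}(j)$, where $$\bar b_{k}(j)=\lim_{n\to\infty}\sum_{i=j+1}^{n-k-1}q_{i-j}\prod_{l=i-j+1}^{i-2}p_l\prod_{l=i}^{k+i}q_l.$$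
   Context: Random derangement process: for $n\ge 2$, $X^{n,\mathbf{p}}=(X_{n+1}=1,X_n,\dots,X_1)$ is the $\{0,1\}$-valued inhomogeneous Markov chain, run in decreasing index and started from $X_{n+1}=1$, such that $X_n=0$ a.s., $X_1=1$ a.s., and for $2\le r\le n-1$: $\mathbb{P}(X_r=0\mid X_{r+1}=0)=p_r$, $\mathbb{P}(X_r=1\mid X_{r+1}=0)=q_r$, $\mathbb{P}(X_r=0\mid X_{r+1}=1)=1$. $C_j(n)$ is the number of $j$-spacings between consecutive $1$s in $(1,X_n,\dots,X_1)$, i.e. the number of occurrences of the pattern $1\,0^{j-1}\,1$. Empty products are $1$ and empty sums are $0$. *)

(* Defs.v *)
From mathcomp Require Import all_boot all_order all_algebra.
From mathcomp Require Import all_classical all_reals all_analysis.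
Set Implicit Arguments.
Unset Strict Implicit.
Unset Printing Implicit Defensive.
Import Order.TTheory GRing.Theory Num.Theory.
Import numFieldNormedType.Exports.
Local Open Scope classical_set_scope.
Local Open Scope ring_scope.

Section RandomDerangementProcess.
Context {d : measure_display} {T : measurableType d} {R : realType}.
Variable P : probability T R.

(* Junk value when [P B = 0]; every use below is guarded by [P B != 0]. *)
Definition cond_prob (A B : set T) : R := fine (P (A `&` B)) / fine (P B).

(* The two states 1 and 0 are [true] and [false]; the time index decreases
   from [n.+1] to [1], and the variables [X i] at other indices are
   irrelevant. *)
Implicit Type X : nat -> {RV P >-> bool}.

Definition state X (i : nat) (b : bool) : set T := [set w | X i w = b].

Definition history X (n r : nat) (x : nat -> bool) : set T :=
  [set w | forall s, (r < s <= n.+1)%N -> X s w = x s].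

Definition decreasing_markov_chain (n : nat) X : Prop :=
  forall (r : nat) (x : nat -> bool), (1 <= r <= n)%N ->
    P (history X n r x) != 0%E ->
    cond_prob (state X r (x r)) (history X n r x) =
    cond_prob (state X r (x r)) (state X r.+1 (x r.+1)).

Record derangement_process (p : nat -> R) (n : nat) X : Prop := {
  dp_markov : decreasing_markov_chain n X;
  dp_start : P (state X n.+1 true) = 1%E;
  dp_first : P (state X n false) = 1%E;
  dp_last : P (state X 1 true) = 1%E;
  dp_00 : forall r, (2 <= r <= n.-1)%N -> P (state X r.+1 false) != 0%E ->
    cond_prob (state X r false) (state X r.+1 false) = p r;
  dp_01 : forall r, (2 <= r <= n.-1)%N -> P (state X r.+1 false) != 0%E ->
    cond_prob (state X r true) (state X r.+1 false) = 1 - p r;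
  dp_10 : forall r, (2 <= r <= n.-1)%N -> P (state X r.+1 true) != 0%E ->
    cond_prob (state X r false) (state X r.+1 true) = 1 }.

(* The number of occurrences of the pattern 1 0^(j-1) 1 in the word
   X_(n+1) X_n ... X_1; [i] is the index of the leading 1. *)
Definition cycle_count (n j : nat) X (w : T) : nat :=
  (\sum_(j.+1 <= i < n.+2)
     [&& X i w, all (fun l => ~~ X l w) (index_iota (i - j).+1 i)
       & X (i - j)%N w])%N.

End RandomDerangementProcess.

Section Barb.
Context {R : realType}.
Variable p : nat -> R.

Definition compl_seq (i : nat) : R := 1 - p i.

Definition bar_b_seq (k j n : nat) : R :=
  \sum_(j.+1 <= i < n - k)
    compl_seq (i - j) * (\prod_((i - j).+1 <= l < i.-1) p l)
      * \prod_(i <= l < (k + i).+1) compl_seq l.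

(* Meaningful only when [bar_b_seq k j] converges. *)
Definition bar_b (k j : nat) : R := limn (bar_b_seq k j).

End Barb.

(* Main.v *)
(* By the Markov property the word 1 0^(j-1) 1 with leading 1 at index i has
   probability u_i q_(i-j) prod p_l, where u_i = P(X_i = 1); and
   u_i = q_i (1 - u_(i+1)) with u_n = 0 unfolds into the alternating sum.
   Exchanging the two sums, the mean is a vanishing term plus
   sum_(k < n) (-1)^k b_k(n), where b_k(n) is nonnegative, nonincreasing in k
   and nondecreasing in n. If i q_i <= M then b_k(n) <= M^3 / k for all n, so
   truncating the alternating sum at K costs at most M^3 / K uniformly in n,
   and the limit exists; stopping after an even number of terms gives the
   bound on the error. *)
Require Import Defs.
From mathcomp Require Import all_boot all_order all_algebra.
From mathcomp Require Import all_classical all_reals all_analysis.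
From mathcomp Require Import measurable_realfun.
From mathcomp Require Import zify ring lra.
Set Implicit Arguments.
Unset Strict Implicit.
Unset Printing Implicit Defensive.
Import Order.TTheory GRing.Theory Num.Theory.
Import numFieldNormedType.Exports.
Local Open Scope classical_set_scope.
Local Open Scope ring_scope.

(** * Truncated alternating sums of nonnegative nonincreasing sequences *)

Section AlternatingSums.
Context {R : realDomainType}.
Implicit Type c : nat -> R.

(** Splitting off the first term leaves [c 0 - s], where by induction [0 <= s <= c 1 <= c 0]. *)
Lemma alternating_sum_bounds c N :
  (forall k, 0 <= c k) -> (forall k, c k.+1 <= c k) ->
  0 <= \sum_(0 <= k < N) (-1) ^+ k * c k <= c 0%N.
Proof.
elim: N c => [|N IH] c c0 cle; first by rewrite big_nil lexx c0.
rewrite big_nat_recl // expr0 mul1r.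
have -> : \sum_(0 <= k < N) (-1) ^+ k.+1 * c k.+1 =
    - \sum_(0 <= k < N) (-1) ^+ k * c k.+1.
  by rewrite -sumrN; apply: eq_bigr => k _; rewrite exprS; ring.
have /andP[s0 s1] := IH (c \o succn) (fun k => c0 _) (fun k => cle _).
by have := cle 0%N; rewrite /= in s0 s1; lra.
Qed.

Lemma alternating_sum_split c K n : (K <= n)%N ->
  \sum_(0 <= k < n) (-1) ^+ k * c k =
  \sum_(0 <= k < K) (-1) ^+ k * c k +
  (-1) ^+ K * \sum_(0 <= k < n - K) (-1) ^+ k * c (K + k)%N.
Proof.
move=> leKn; rewrite (@big_cat_nat _ _ _ K) //=; congr (_ + _).
rewrite -{1}[K]add0n big_addn mulr_sumr; apply: eq_bigr => k _.
by rewrite mulrA -exprD addnC.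
Qed.

Lemma alternating_tail_bounds c K N :
  (forall k, 0 <= c k) -> (forall k, c k.+1 <= c k) ->
  0 <= \sum_(0 <= k < N) (-1) ^+ k * c (K + k)%N <= c K.
Proof.
move=> c0 cle; rewrite -[in c K](addn0 K).
by apply: (@alternating_sum_bounds (fun k => c (K + k)%N)) => k //;
  rewrite addnS.
Qed.

(** Beyond [K] the sum is, up to sign, an alternating sum that starts at [c K]. *)
Lemma alternating_sum_dist c K n : (K <= n)%N ->
  (forall k, 0 <= c k) -> (forall k, c k.+1 <= c k) ->
  `|\sum_(0 <= k < n) (-1) ^+ k * c k - \sum_(0 <= k < K) (-1) ^+ k * c k|
    <= c K.
Proof.
move=> leKn c0 cle; rewrite (alternating_sum_split _ leKn) addrC addKr.
rewrite normrM normrX normrN1 expr1n mul1r.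
have /andP[s0] := alternating_tail_bounds K (n - K) c0 cle.
by rewrite ger0_norm.
Qed.

(** After an even number of terms the tail enters with sign [+], so its upper bound carries over. *)
Lemma alternating_sum_le_even c m n : (2 * m <= n)%N ->
  (forall k, 0 <= c k) -> (forall k, c k.+1 <= c k) ->
  \sum_(0 <= k < n) (-1) ^+ k * c k <=
  \sum_(0 <= k < 2 * m) (-1) ^+ k * c k + c (2 * m)%N.
Proof.
move=> lemn c0 cle; rewrite (alternating_sum_split _ lemn) lerD2l.
rewrite exprM sqrrN expr1n expr1n mul1r.
by have /andP[_] := alternating_tail_bounds (2 * m) (n - 2 * m) c0 cle.
Qed.

End AlternatingSums.

(** * Sign and monotonicity of [bar_b_seq], and the exchange of summations *)

Section BarB.
Context {R : realType}.
Variable p : nat -> R.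
Hypothesis p01 : forall i, (0 < i)%N -> 0 <= p i <= 1.

Local Notation q := (compl_seq p).

Let q01 i : (0 < i)%N -> 0 <= q i <= 1.
Proof. by move=> /p01; rewrite /compl_seq; lra. Qed.

Lemma prodr_nat_01 (f : nat -> R) a b :
  (forall i, (0 < i)%N -> 0 <= f i <= 1) -> (0 < a)%N ->
  0 <= \prod_(a <= l < b) f l <= 1.
Proof.
move=> f01 a0; rewrite big_nat_cond.
apply: (big_ind (fun x : R => 0 <= x <= 1)).
- by rewrite ler01 lexx.
- move=> x y /andP[x0 x1] /andP[y0 y1].
  by rewrite mulr_ge0 //= mulr_ile1.
- by move=> i /andP[/andP[ai _] _]; apply: f01; apply: leq_trans ai.
Qed.

(** In the process, for [j > 1], this is the probability, given [X_i = 1], that the next 1 is at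
    [i - j]; the product stops at [i - 2] because the step from [i] to [i - 1] is forced. *)
Definition gap_weight j i : R :=
  q (i - j)%N * (\prod_((i - j).+1 <= l < i.-1) p l).

Lemma gap_weight_bounds j i : (j < i)%N -> 0 <= gap_weight j i <= q (i - j)%N.
Proof.
move=> ji; rewrite /gap_weight.
have ij : (0 < i - j)%N by rewrite subn_gt0.
have /andP[q0 _] := q01 ij.
have /andP[p0 p1] := @prodr_nat_01 p (i - j).+1 i.-1 p01 isT.
by rewrite mulr_ge0 //= ler_piMr.
Qed.

Lemma prodq_recr i k :
  \prod_(i <= l < (k.+1 + i).+1) q l =
  (\prod_(i <= l < (k + i).+1) q l) * q (k.+1 + i)%N.
Proof. by rewrite big_nat_recr ?addSn //=; lia. Qed.

Lemma bar_term_ge0 j i k : (j < i)%N ->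
  0 <= q (i - j)%N * (\prod_((i - j).+1 <= l < i.-1) p l)
    * \prod_(i <= l < (k + i).+1) q l.
Proof.
move=> ji; have /andP[a0 _] := gap_weight_bounds ji.
have /andP[Q0 _] := prodr_nat_01 (k + i).+1 q01 (leq_ltn_trans (leq0n j) ji).
exact: mulr_ge0.
Qed.

Lemma bar_b_seq_ge0 k j n : 0 <= bar_b_seq p k j n.
Proof.
rewrite /bar_b_seq big_nat_cond; apply: sumr_ge0 => i /andP[/andP[ji _] _].
exact: bar_term_ge0.
Qed.

(** Raising [k] shortens the range and gives each term one more factor [q <= 1]. *)
Lemma bar_b_seq_nincr k j n : bar_b_seq p k.+1 j n <= bar_b_seq p k j n.
Proof.
rewrite /bar_b_seq.
have [lejn|ltnj] := leqP j.+1 (n - k.+1); last first.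
  by rewrite big_geq 1?ltnW //; exact: bar_b_seq_ge0.
rewrite [leRHS](@big_cat_nat _ _ _ (n - k.+1)) //=; last by lia.
rewrite -[leLHS]addr0 lerD //.
  rewrite big_nat_cond [leRHS]big_nat_cond.
  apply: ler_sum => i /andP[/andP[ji _] _].
  have /andP[a0 _] := gap_weight_bounds ji.
  rewrite ler_wpM2l // prodq_recr ler_piMr //.
    by rewrite (andP (prodr_nat_01 _ q01 _)).1 //; lia.
  by have /andP[] : 0 <= q (k.+1 + i)%N <= 1 by apply: q01; lia.
rewrite big_nat_cond; apply: sumr_ge0 => i /andP[/andP[ji _] _].
by apply: bar_term_ge0; lia.
Qed.

(** The summand does not involve [n]: only the range grows, by nonnegative terms. *)
Lemma bar_b_seq_ndecr k j : nondecreasing_seq (bar_b_seq p k j).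
Proof.
move=> n n' lenn'; rewrite /bar_b_seq.
have [lejn|ltnj] := leqP j.+1 (n - k); last first.
  by rewrite big_geq 1?ltnW //; exact: bar_b_seq_ge0.
rewrite [leRHS](@big_cat_nat _ _ _ (n - k)) //=; last by lia.
rewrite lerDl.
rewrite big_nat_cond; apply: sumr_ge0 => i /andP[/andP[ji _] _].
by apply: bar_term_ge0; lia.
Qed.

Lemma alternating_bar_b_seq j n :
  \sum_(j.+1 <= i < n) \sum_(0 <= k < n - i)
     (-1) ^+ k * q (i - j)%N * (\prod_((i - j).+1 <= l < i.-1) p l)
       * \prod_(i <= l < (k + i).+1) q l =
  \sum_(0 <= k < n) (-1) ^+ k * bar_b_seq p k j n.
Proof.
pose F i k := (-1) ^+ k * (gap_weight j i * \prod_(i <= l < (k + i).+1) q l).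
(* The inner range is widened to a fixed one with a guard, so that the sums can be exchanged; the
   guard [k < n - i] then reads [i < n - k]. *)
transitivity (\sum_(j.+1 <= i < n) \sum_(0 <= k < n | (k < n - i)%N) F i k).
  apply: eq_bigr => i _.
  rewrite (@big_nat_widen _ _ _ 0 (n - i) n) ?leq_subr //.
  by apply: eq_big => k //= _; rewrite /F /gap_weight !mulrA.
rewrite (exchange_big_dep_nat xpredT) //=; apply: eq_bigr => k _.
rewrite /bar_b_seq mulr_sumr.
rewrite [RHS](@big_nat_widen _ _ _ _ (n - k) n) ?leq_subr //.
by apply: eq_bigl => i; lia.
Qed.

(** * Bounds uniform in [n], and limits, when [i * q_i <= M] *)

Section Decay.
Variable M : R.
Hypothesis qM : forall i, i%:R * q i <= M.

Let M0 : 0 <= M.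
Proof. by apply: le_trans (qM 0%N); rewrite mul0r. Qed.

Let q_le i : (0 < i)%N -> q i <= M / i%:R.
Proof. by move=> i0; rewrite ler_pdivlMr ?ltr0n // mulrC. Qed.

Lemma sum_compl_seq_le j n : (0 < j)%N ->
  \sum_(j.+1 <= i < n) q (i - j)%N * q i <= M ^+ 2.
Proof.
move=> j0; have [jn|nj] := ltnP j n; last first.
  by rewrite big_geq ?exprn_ge0 // ltnW.
(* 1 / ((i - j) i) <= 1 / (i - j) - 1 / (i - j + 1), which telescopes *)
apply: (@le_trans _ _ (\sum_(j.+1 <= i < n)
   M ^+ 2 * ((i - j)%:R^-1 - (i.+1 - j)%:R^-1))).
  rewrite big_nat_cond [leRHS]big_nat_cond.
  apply: ler_sum => i /andP[/andP[ji _] _].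
  have ij0 : (0 < i - j)%N by lia.
  have i0 : (0 < i)%N by lia.
  have /andP[qi0 _] := q01 i0; have /andP[qij0 _] := q01 ij0.
  apply: (@le_trans _ _ (M / (i - j)%:R * (M / i%:R))).
    by rewrite ler_pM // q_le.
  have -> : (i.+1 - j = (i - j).+1)%N by lia.
  have x0 : 0 < (i - j)%:R :> R by rewrite ltr0n.
  (* Here [j >= 1] enters, through [1 / i <= 1 / (i - j + 1)]. *)
  have xi : (i - j).+1%:R <= i%:R :> R by rewrite ler_nat; lia.
  have -> : M / (i - j)%:R * (M / i%:R) = M ^+ 2 * ((i - j)%:R^-1 / i%:R).
    by rewrite expr2; ring.
  rewrite ler_wpM2l ?exprn_ge0 //.
  have -> : (i - j)%:R^-1 - (i - j).+1%:R^-1 =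
      (i - j)%:R^-1 / (i - j).+1%:R :> R.
    by rewrite -natr1; field; lra.
  rewrite ler_wpM2l ?invr_ge0 ?ler0n // lef_pV2 // posrE ?ltr0n //.
rewrite -mulr_sumr ler_piMr ?exprn_ge0 //.
rewrite (@telescope_sumr_eq _ _ _ (fun i => - (i - j)%:R^-1)) //; last first.
  by move=> i _; rewrite opprK addrC.
(* The telescoped sum is [1 - 1 / (n - j)]. *)
by rewrite opprK subSnn invr1 gerDr oppr_le0 invr_ge0 ler0n.
Qed.

(** Monotonicity in [k] reduces to [k = 0], where each term is at most [q_(i-j) q_i]. *)
Lemma bar_b_seq_le k j n : (0 < j)%N -> bar_b_seq p k j n <= M ^+ 2.
Proof.
move=> j0; elim: k => [|k]; last exact: le_trans (bar_b_seq_nincr _ _ _).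
apply: le_trans (@sum_compl_seq_le j n j0).
rewrite /bar_b_seq subn0 big_nat_cond [leRHS]big_nat_cond.
apply: ler_sum => i /andP[/andP[ji _] _].
have /andP[a0 a1] := gap_weight_bounds ji.
rewrite add0n big_nat1 ler_wpM2r // (andP (q01 _)).1 //; lia.
Qed.

(** Uniformity in [n] lets a truncation level be fixed before [n] grows. *)
Lemma bar_b_seq_le_decay k j n : (0 < j)%N ->
  bar_b_seq p k.+1 j n <= M ^+ 3 / k.+1%:R.
Proof.
move=> j0; have -> : M ^+ 3 / k.+1%:R = M ^+ 2 * (M / k.+1%:R) :> R.
  by rewrite exprS; ring.
have Mk0 : 0 <= M / k.+1%:R by rewrite divr_ge0.
apply: le_trans (ler_wpM2r Mk0 (@bar_b_seq_le k j n j0)).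
rewrite /bar_b_seq mulr_suml.
have [lejn|ltnj] := leqP j.+1 (n - k.+1); last first.
  rewrite big_geq 1?ltnW // -mulr_suml mulr_ge0 //.
  exact: bar_b_seq_ge0.
rewrite [leRHS](@big_cat_nat _ _ _ (n - k.+1)) //=; last by lia.
rewrite -[leLHS]addr0 lerD //.
  rewrite big_nat_cond [leRHS]big_nat_cond.
  apply: ler_sum => i /andP[/andP[ji _] _].
  have /andP[a0 _] := gap_weight_bounds ji.
  have /andP[Q0 _] := prodr_nat_01 (k + i).+1 q01 (leq_ltn_trans (leq0n j) ji).
  (* the decay comes from the last factor q_(i+k+1) <= M / (k+1) *)
  rewrite prodq_recr mulrA; apply: ler_wpM2l; first by rewrite mulr_ge0.
  apply: (@le_trans _ _ (M / (k.+1 + i)%:R)); first by apply: q_le; lia.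
  rewrite ler_wpM2l // lef_pV2 ?posrE ?ltr0n // ler_nat; lia.
rewrite big_nat_cond; apply: sumr_ge0 => i /andP[/andP[ji _] _].
by rewrite mulr_ge0 // bar_term_ge0 //; lia.
Qed.

Lemma cvgn_bar_b_seq k j : (0 < j)%N -> cvgn (bar_b_seq p k j).
Proof.
move=> j0; apply: nondecreasing_is_cvgn; first exact: bar_b_seq_ndecr.
by exists (M ^+ 2) => _ [n _ <-]; exact: bar_b_seq_le.
Qed.

Lemma cvg_partial_alternating K j : (0 < j)%N ->
  (fun n => \sum_(0 <= k < K) (-1) ^+ k * bar_b_seq p k j n) @ \oo -->
  \sum_(0 <= k < K) (-1) ^+ k * bar_b p k j.
Proof.
move=> j0; apply: (@cvg_big _ _ +%R) => [|k _]; first exact: add_continuous.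
by apply: cvgMr; exact: cvgn_bar_b_seq.
Qed.

(** A Cauchy argument: the sum is within [e / 2] of a truncation of fixed length, which converges
    termwise. *)
Lemma cvgn_alternating_bar_b_seq j : (0 < j)%N ->
  cvgn (fun n => \sum_(0 <= k < n) (-1) ^+ k * bar_b_seq p k j n).
Proof.
move=> j0; apply/cauchy_cvgP/cauchy_exP => e e0.
have e2 : 0 < e / 2 by rewrite divr_gt0.
pose K := Num.truncn (M ^+ 3 / (e / 2)).
have Ke : M ^+ 3 / K.+1%:R < e / 2.
  rewrite ltr_pdivrMr ?ltr0n // mulrC -ltr_pdivrMr //.
  by rewrite truncnS_gt.
(* This form of the Cauchy criterion asks for one ball of radius [e] that captures the tail; its
   centre [L] may depend on [e]. *)
pose L := \sum_(0 <= k < K.+1) (-1) ^+ k * bar_b p k j.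
have cvgL := @cvg_partial_alternating K.+1 j j0.
exists L; move/cvgrPdist_lt : cvgL => /(_ _ e2) cvgL.
suff : \forall n \near \oo,
    `|L - \sum_(0 <= k < n) (-1) ^+ k * bar_b_seq p k j n| < e by [].
near=> n.
have leKn : (K.+1 <= n)%N by near: n; exact: nbhs_infty_ge.
have := @alternating_sum_dist R (fun k => bar_b_seq p k j n) K.+1 n leKn
  (fun k => bar_b_seq_ge0 _ _ _) (fun k => bar_b_seq_nincr _ _ _).
have := bar_b_seq_le_decay K n j0.
have : `|L - \sum_(0 <= k < K.+1) (-1) ^+ k * bar_b_seq p k j n| < e / 2.
  by near: n.
set x := \sum_(0 <= k < K.+1) _; set y := \sum_(0 <= k < n) _.
move=> Lx bK yx; rewrite -[L](subrK x) -addrA (le_lt_trans (ler_normD _ _)) //.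
rewrite (splitr e) ltr_leD // distrC (le_trans yx) // (le_trans bK) // ltW //.
Unshelve. all: by end_near. Qed.

(** The even truncation bounds the sum for each [n >= 2 * m], and the inequality passes to the
    limit. *)
Lemma limn_alternating_bar_b_seq_le j m : (0 < j)%N ->
  limn (fun n => \sum_(0 <= k < n) (-1) ^+ k * bar_b_seq p k j n) <=
  \sum_(0 <= k < 2 * m) (-1) ^+ k * bar_b p k j + bar_b p (2 * m) j.
Proof.
move=> j0; have cvgB : (fun n => \sum_(0 <= k < 2 * m)
    (-1) ^+ k * bar_b_seq p k j n + bar_b_seq p (2 * m) j n) @ \oo -->
    \sum_(0 <= k < 2 * m) (-1) ^+ k * bar_b p k j + bar_b p (2 * m) j.
  by apply: cvgD; [exact: cvg_partial_alternating | exact: cvgn_bar_b_seq].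
rewrite -(cvg_lim _ cvgB) //; apply: ler_lim.
- exact: cvgn_alternating_bar_b_seq.
- by apply/cvg_ex; eexists; exact: cvgB.
- near=> n; apply: (@alternating_sum_le_even _ (fun k => bar_b_seq p k j n)).
  + by near: n; exact: nbhs_infty_ge.
  + by move=> k; exact: bar_b_seq_ge0.
  + by move=> k; exact: bar_b_seq_nincr.
Unshelve. all: by end_near. Qed.

(** This is the contribution of the leading 1 at [n + 1] to the mean; the product is at most 1 and
    the factor [q] tends to 0. *)
Lemma cvg_first_cycle_weight j :
  (fun n => q (n - j).+1 * \prod_((n - j).+2 <= l < n) p l) @ \oo --> 0.
Proof.
(* Shifting by [j] removes the truncated subtraction and leaves the bound [M / (n + 1)]. *)
rewrite -(cvg_shiftn j) /=.
have cvgM : (fun n => M * n.+1%:R^-1) @ \oo --> 0.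
  by rewrite -(mulr0 M); apply: cvgMr; exact: cvg_harmonic.
apply: squeeze_cvgr (cvg_cst 0) cvgM; near=> n; rewrite addnK.
have /andP[q0 _] := @q01 n.+1 isT.
have /andP[p0 p1] := @prodr_nat_01 p n.+2 (n + j) p01 isT.
by rewrite mulr_ge0 //= (le_trans (ler_piMr _ _)) // q_le.
Unshelve. all: by end_near. Qed.

End Decay.
End BarB.

(** * Path probabilities of the Markov chain, and the mean count as a sum of word probabilities *)

Section MarkovPaths.
Context {d : measure_display} {T : measurableType d} {R : realType}.
Variable P : probability T R.
Implicit Types (A B : set T) (X : nat -> {RV P >-> bool}) (x : nat -> bool).

Definition prob A : R := fine (P A).

Lemma probK A : measurable A -> (prob A)%:E = P A.
Proof. by move=> mA; rewrite fineK // fin_num_measure. Qed.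

Lemma prob_ge0 A : 0 <= prob A.
Proof. by rewrite fine_ge0. Qed.

Lemma prob_ne0 A : prob A != 0 -> P A != 0%E.
Proof. by apply: contra_neq => A0; rewrite /prob A0. Qed.

Lemma prob_setI_split A B : measurable A -> measurable B ->
  prob A = prob (A `&` B) + prob (A `&` ~` B).
Proof.
move=> mA mB; rewrite /prob -fineD ?fin_num_measure //; last 2 first.
- exact: measurableI.
- by apply: measurableI => //; exact: measurableC.
rewrite -measureU.
- by rewrite -setIUr setUCr setIT.
- exact: measurableI.
- by apply: measurableI => //; exact: measurableC.
- by rewrite setIACA setICr setI0.
Qed.

Lemma prob_le A B : measurable A -> measurable B -> A `<=` B ->
  prob A <= prob B.
Proof.
move=> mA mB AB; rewrite fine_le ?fin_num_measure //.
by apply: le_measure => //; rewrite inE.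
Qed.

Lemma prob_eq0W A B : measurable A -> measurable B -> A `<=` B ->
  prob B = 0 -> prob A = 0.
Proof.
by move=> mA mB AB B0; apply/eqP; rewrite eq_le prob_ge0 andbT -B0 prob_le.
Qed.

Lemma measurable_state X i b : measurable (state X i b).
Proof. exact: (measurable_funPTI (X i) (Y := [set b])). Qed.

Lemma state_setC X i b : ~` state X i b = state X i (~~ b).
Proof.
by apply/seteqP; split => w; rewrite /state /=; case: (X i w); case: b.
Qed.

Lemma prob_state_split X i b A : measurable A ->
  prob A = prob (A `&` state X i b) + prob (A `&` state X i (~~ b)).
Proof.
move=> mA; rewrite -state_setC; apply: prob_setI_split => //.
exact: measurable_state.
Qed.

Lemma prob_stateC X i b : prob (state X i b) + prob (state X i (~~ b)) = 1.
Proof.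
have := @prob_state_split X i b setT measurableT.
by rewrite !setTI => <-; rewrite /prob probability_setT.
Qed.

(** If [B] is null, so is the intersection, and the junk value of [cond_prob] is multiplied by 0. *)
Lemma cond_probK A B : measurable A -> measurable B ->
  prob B * cond_prob P A B = prob (A `&` B).
Proof.
move=> mA mB; rewrite /cond_prob -/(prob _) -/(prob B).
have [B0|B0] := eqVneq (prob B) 0; last by rewrite mulrC divfK.
rewrite B0 mul0r; apply/esym/(@prob_eq0W _ B) => //.
exact: measurableI.
Qed.

(** Generalises [history], the window from [r + 1] to [n + 1], to windows with any upper end. *)
Definition segment X a c x : set T :=
  [set w | forall s, (a <= s <= c)%N -> X s w = x s].

Lemma segment1 X a x : segment X a a x = state X a (x a).
Proof.
apply/seteqP; split => w /=; first by apply; rewrite leqnn.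
by move=> wa s; rewrite -eqn_leq => /eqP <-.
Qed.

Lemma segment_recl X a c x : (a <= c)%N ->
  segment X a c x = state X a (x a) `&` segment X a.+1 c x.
Proof.
move=> ac; apply/seteqP; split => w /=.
  move=> H; split; first by apply: H; rewrite leqnn.
  by move=> s /andP[/ltnW as1 sc]; apply: H; rewrite as1.
move=> [Ha H] s /andP[]; rewrite leq_eqVlt => /orP[/eqP <-//|as1 sc].
by apply: H; rewrite as1.
Qed.

Lemma segment_recr X a c x : (a <= c.+1)%N ->
  segment X a c.+1 x = segment X a c x `&` state X c.+1 (x c.+1).
Proof.
move=> ac; apply/seteqP; split => w /=.
  move=> H; split; last by apply: H; rewrite leqnn ac.
  by move=> s /andP[as1 sc]; apply: H; rewrite as1 leqW.
move=> [H Hc] s /andP[as1]; rewrite leq_eqVlt => /orP[/eqP ->//|sc].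
by apply: H; rewrite as1.
Qed.

Lemma measurable_segment X a c x : measurable (segment X a c x).
Proof.
have [ac|ca] := leqP a c; last first.
  have -> : segment X a c x = setT; last exact: measurableT.
  by apply/seteqP; split => // w _ s; lia.
elim: c ac => [|c IH] ac.
  move: ac; rewrite leqn0 => /eqP ->; rewrite segment1.
  exact: measurable_state.
move: ac; rewrite leq_eqVlt => /orP[/eqP ->|ac].
  by rewrite segment1; exact: measurable_state.
rewrite (segment_recr _ _ (ltnW ac)); apply: measurableI; first exact: IH.
exact: measurable_state.
Qed.

Lemma eq_segment X a c x y : (forall s, (a <= s <= c)%N -> x s = y s) ->
  segment X a c x = segment X a c y.
Proof.
by move=> xy; apply/seteqP; split => w H s sc; rewrite H // xy.
Qed.

Definition transition X r x : R :=
  cond_prob P (state X r (x r)) (state X r.+1 (x r.+1)).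

(** States are added downwards: what lies above [a] is a history, so the Markov property supplies
    the next factor. *)
Lemma prob_full_segment n X x a : decreasing_markov_chain n X ->
  (1 <= a <= n.+1)%N ->
  prob (segment X a n.+1 x) =
  prob (state X n.+1 (x n.+1)) * \prod_(a <= r < n.+1) transition X r x.
Proof.
move=> mX /andP[a1 an]; have [k ka] : exists k, (a + k = n.+1)%N.
  by exists (n.+1 - a)%N; lia.
elim: k a a1 an ka => [|k IH] a a1 an ka.
  by rewrite addn0 in ka; rewrite ka segment1 big_geq // mulr1.
have an' : (a < n.+1)%N by lia.
rewrite (segment_recl _ _ (ltnW an')) big_ltn // mulrCA -IH //; last lia.
have hist : history X n a x = segment X a.+1 n.+1 x by [].
rewrite -cond_probK; [|exact: measurable_state|exact: measurable_segment].
rewrite [RHS]mulrC.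
(* A null history makes both sides vanish; otherwise the Markov property applies. *)
have [s0|s0] := eqVneq (prob (segment X a.+1 n.+1 x)) 0.
  by rewrite s0 !mul0r.
congr (_ * _); rewrite -hist mX //; first by rewrite a1.
by rewrite hist; exact: prob_ne0.
Qed.

(* The Markov property only conditions on histories starting at time n+1;
   the states above c are summed out one at a time. *)
Lemma prob_segment n X x a c : decreasing_markov_chain n X ->
  (1 <= a)%N -> (a <= c)%N -> (c <= n.+1)%N ->
  prob (segment X a c x) =
  prob (state X c (x c)) * \prod_(a <= r < c) transition X r x.
Proof.
move=> mX a1 ac cn; have [k ck] : exists k, (c + k = n.+1)%N.
  by exists (n.+1 - c)%N; lia.
elim: k c x ac cn ck => [|k IH] c x ac cn ck.
  by rewrite addn0 in ck; rewrite ck; apply: prob_full_segment => //; lia.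
pose y b s := if s == c.+1 then b else x s.
have yE b s : (s <= c)%N -> y b s = x s by rewrite /y; case: eqP => // ->; lia.
have yc b : y b c.+1 = b by rewrite /y eqxx.
(* The induction hypothesis at [c + 1] ends with the transition from [c + 1] to [c], which merges
   with the law of [X_(c+1)] into a joint probability; summing over [b] will give the claim. *)
have trans b : prob (segment X a c x `&` state X c.+1 b) =
    prob (state X c (x c) `&` state X c.+1 b) *
      \prod_(a <= r < c) transition X r x.
  rewrite (@eq_segment _ _ _ _ (y b)); last by move=> s /andP[_ sc]; rewrite yE.
  rewrite -{2}(yc b) -segment_recr; last lia.
  rewrite IH; [|lia..]; rewrite big_nat_recr //= yc mulrCA.
  rewrite {2}/transition yc yE // cond_probK; first last.
  - exact: measurable_state.
  - exact: measurable_state.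
  rewrite mulrC; congr (_ * _).
  by apply: eq_big_nat => r /andP[_ rc]; rewrite /transition !yE // ltnW.
rewrite (@prob_state_split X c.+1 true); last exact: measurable_segment.
rewrite (@prob_state_split X c.+1 true (state X c _)); last first.
  exact: measurable_state.
by rewrite !trans mulrDl.
Qed.

(** Only the window from [i - j] to [i] matters; there it spells [1 0^(j-1) 1]. *)
Definition cycle_word j i (s : nat) : bool := (s == i) || (s == i - j)%N.

(** Linearity of expectation: the count is a sum of indicators of [segment] events. *)
Lemma expectation_cycle_count n j X : (0 < j)%N ->
  'E_P[fun w => (cycle_count n j X w)%:R]%E =
  (\sum_(j.+1 <= i < n.+2) prob (segment X (i - j) i (cycle_word j i)))%:E.
Proof.
move=> j0; pose S i := segment X (i - j) i (cycle_word j i).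
have countE w : ((cycle_count n j X w)%:R : R)%:E =
    (\sum_(i <- index_iota j.+1 n.+2) (\1_(S i) w : R)%:E)%E.
  rewrite sumEFin /cycle_count natr_sum; congr (_%:E).
  apply: eq_big_nat => i /andP[ji _]; rewrite indicE.
  congr (_%:R); congr nat_of_bool.
  apply/idP/idP.
    move=> /and3P[Xi /allP X0 Xj]; rewrite inE => s /andP[js si].
    rewrite /cycle_word; have [->|nsi] := eqVneq s i; first by rewrite Xi.
    have [->|nsj] := eqVneq s (i - j)%N; first by rewrite Xj orbT.
    by apply/negbTE/X0; rewrite mem_index_iota; lia.
  rewrite inE => Sw; apply/and3P; split.
  - by rewrite Sw ?/cycle_word ?eqxx //; lia.
  - apply/allP => s; rewrite mem_index_iota => sij.
    by rewrite Sw /cycle_word; lia.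
  - by rewrite Sw ?/cycle_word ?eqxx ?orbT //; lia.
rewrite unlock; under eq_integral do rewrite countE.
rewrite ge0_integral_sum //; last first.
  move=> i; apply/measurable_EFinP; apply: measurable_indic.
  exact: measurable_segment.
rewrite -sumEFin; apply: eq_bigr => i _.
by rewrite integral_indic ?setIT ?probK //; exact: measurable_segment.
Qed.

End MarkovPaths.

(** * State probabilities, word probabilities and the mean for the derangement process *)

Section DerangementProcess.
Context {d : measure_display} {T : measurableType d} {R : realType}.
Variables (P : probability T R) (p : nat -> R) (n : nat).
Variable X : nat -> {RV P >-> bool}.
Hypothesis p1 : p 1%N = 0.
Hypothesis p_gt0 : forall i, (2 <= i)%N -> 0 < p i.
Hypothesis p_le1 : forall i, (2 <= i)%N -> p i <= 1.
Hypothesis n2 : (2 <= n)%N.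
Hypothesis XP : derangement_process p n X.

Local Notation q := (compl_seq p).
Local Notation st r b := (prob P (state X r b)).

Let stC r b : st r b + st r (~~ b) = 1.
Proof. exact: prob_stateC. Qed.

Let mst r b : measurable (state X r b).
Proof. exact: measurable_state. Qed.

Let st_start : st n.+1 true = 1.
Proof. by rewrite /prob (dp_start XP). Qed.

Let st_first : st n true = 0.
Proof. by have := stC n true; rewrite /= {2}/prob (dp_first XP) /=; lra. Qed.

(** For [r < n] this is the forced transition from 1 to 0; for [r = n] it holds because [X_n = 0]
    almost surely. *)
Lemma prob_state10 r : (2 <= r <= n)%N ->
  prob P (state X r false `&` state X r.+1 true) = st r.+1 true.
Proof.
move=> /andP[r2 rn]; have [rn1|] := leqP r n.-1.
  rewrite -cond_probK //.
  have [->|s0] := eqVneq (st r.+1 true) 0; first by rewrite mul0r.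
  by rewrite (dp_10 XP) ?mulr1 ?r2 //; exact: prob_ne0.
move=> nr; have -> : r = n by lia.
rewrite [RHS](prob_state_split X n true) // [X in _ = X + _](_ : _ = 0) ?add0r.
  by rewrite setIC.
by apply: (@prob_eq0W _ _ _ _ _ (state X n true)) => //; exact: measurableI.
Qed.

(** Almost surely, a 1 at [r] can only come from a 0 at [r + 1]. *)
Lemma prob_state_rec r : (2 <= r < n)%N ->
  st r true = q r * (1 - st r.+1 true).
Proof.
move=> /andP[r2 rn]; have -> : 1 - st r.+1 true = st r.+1 false.
  by rewrite -(stC r.+1 true) addrC addKr.
have H10 : prob P (state X r false `&` state X r.+1 true) = st r.+1 true.
  by apply: prob_state10; rewrite r2 ltnW.
have := prob_state_split X r false (mst r.+1 true).
(* Cancellation shows that two adjacent 1s form a null event. *)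
rewrite setIC H10 -[LHS]addr0 => /addrI /=; rewrite setIC => H11.
rewrite (prob_state_split X r.+1 true) //= -H11 add0r -cond_probK // mulrC.
have [->|s0] := eqVneq (st r.+1 false) 0; first by rewrite !mulr0.
by rewrite (dp_01 XP) //; [lia | exact: prob_ne0].
Qed.

(** Discharges the guards of [dp_00] and [dp_01]. For [r < n] the recursion gives
    [P(X_r = 1) <= q_r < 1], as [p_r > 0]. *)
Lemma prob_state_false_ne0 r : (2 <= r <= n)%N -> st r false != 0.
Proof.
move=> /andP[r2]; rewrite leq_eqVlt => /orP[/eqP ->|rn].
  by apply/eqP; have := stC n true; rewrite /= st_first; lra.
suff : st r true < 1 by have := stC r true; rewrite /=; lra.
rewrite prob_state_rec ?r2 //.
have s0 : 0 <= st r.+1 true by exact: prob_ge0.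
have := p_gt0 r2; have := p_le1 r2; rewrite /compl_seq; nra.
Qed.

(** Along the word the first transition is forced, the last contributes [q], and each one between
    stays at 0 and contributes [p]. *)
Lemma prob_cycle_word j i : (1 < j < i)%N -> (i <= n.+1)%N ->
  prob P (segment X (i - j) i (cycle_word j i)) =
  st i true * (q (i - j)%N * \prod_((i - j).+1 <= l < i.-1) p l).
Proof.
case: i => [|i] /andP[j1 ji] iN; first by [].
have xi : cycle_word j i.+1 i.+1 = true by rewrite /cycle_word eqxx.
have xj : cycle_word j i.+1 (i.+1 - j)%N = true.
  by rewrite /cycle_word eqxx orbT.
have x0 s : (i.+1 - j < s < i.+1)%N -> cycle_word j i.+1 s = false.
  by move=> sij; rewrite /cycle_word; lia.
rewrite (prob_segment _ (dp_markov XP)) ?leq_subr //; last lia.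
rewrite xi big_nat_recr /=; last lia.
have -> : transition X i (cycle_word j i.+1) =
    cond_prob P (state X i false) (state X i.+1 true).
  by rewrite /transition xi x0 //; lia.
rewrite mulrCA cond_probK // prob_state10; last lia.
rewrite mulrC; congr (_ * _); rewrite big_ltn; last lia.
congr (_ * _).
  rewrite /transition xj x0; last lia.
  have [ij1|ij1] := eqVneq (i.+1 - j)%N 1%N; last first.
    rewrite (dp_01 XP) //; first lia.
    by apply/prob_ne0/prob_state_false_ne0; lia.
  (* q_1 = 1 agrees with X_1 = 1 almost surely *)
  rewrite ij1 /compl_seq p1 subr0.
  (* Multiplying by [P(X_2 = 0)], which is not 0, turns the claim into one about joint
     probabilities. *)
  apply: (mulfI (@prob_state_false_ne0 2 _)); first lia.
  rewrite mulr1 cond_probK // [RHS](prob_state_split X 1%N true) //.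
  rewrite setIC -[LHS]addr0; congr (_ + _); apply/esym.
  apply: (@prob_eq0W _ _ _ _ _ (state X 1%N false)) => //.
    exact: measurableI.
  by have := stC 1%N true; rewrite /= {1}/prob (dp_last XP) /=; lra.
apply: eq_big_nat => r /andP[ijr ri].
rewrite /transition !x0; [|lia..].
rewrite (dp_00 XP) //; first lia.
by apply/prob_ne0/prob_state_false_ne0; lia.
Qed.

(** Downward induction from [P(X_n = 1) = 0]: the recursion puts [q_i] in front of every product for
    [i + 1] and flips its sign, and its constant term gives [k = 0]. *)
Lemma prob_state_alternating i : (2 <= i <= n)%N ->
  st i true = \sum_(0 <= k < n - i) (-1) ^+ k * \prod_(i <= l < (k + i).+1) q l.
Proof.
move=> /andP[i2 iN]; have [k kE] : exists k, (i + k = n)%N.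
  by exists (n - i)%N; lia.
elim: k i i2 iN kE => [|k IH] i i2 iN kE.
  by rewrite addn0 in kE; rewrite kE subnn big_nil st_first.
rewrite prob_state_rec; last lia.
rewrite IH; [|lia..].
have -> : (n - i = (n - i.+1).+1)%N by lia.
rewrite big_nat_recl // expr0 mul1r add0n big_nat1 mulrBr mulr1; congr (_ + _).
rewrite -mulrN -sumrN mulr_sumr; apply: eq_bigr => l _.
rewrite [in RHS]big_ltn; last lia.
by rewrite addSn addnS exprS; ring.
Qed.

Lemma expectation_derangement_cycle_count j : (1 < j <= n)%N ->
  'E_P[fun w => (cycle_count n j X w)%:R]%E =
  (q (n - j).+1 * \prod_((n - j).+2 <= l < n) p l
   + \sum_(j.+1 <= i < n) \sum_(0 <= k < n - i)
       (-1) ^+ k * q (i - j)%N * (\prod_((i - j).+1 <= l < i.-1) p l)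
         * \prod_(i <= l < (k + i).+1) q l)%:E.
Proof.
move=> /andP[j1 jn]; rewrite expectation_cycle_count; last lia.
(* The leading 1 at [n + 1] is almost sure and yields the isolated term. *)
congr (_%:E); rewrite big_nat_recr /=; last lia.
rewrite prob_cycle_word ?st_start ?mul1r; [|lia..].
have -> : (n.+1 - j = (n - j).+1)%N by lia.
rewrite addrC /=; congr (_ + _).
transitivity (\sum_(j.+1 <= i < n)
    prob P (segment X (i - j) i (cycle_word j i))).
  (* The index [i = n] contributes nothing since [X_n = 0] almost surely; for [j = n] both sums are
     empty. *)
  move: jn; rewrite leq_eqVlt => /orP[/eqP <-|jn]; first by rewrite !big_geq.
  rewrite big_nat_recr //= prob_cycle_word; [|lia..].
  by rewrite st_first mul0r addr0.
apply: eq_big_nat => i /andP[ji iN].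
rewrite prob_cycle_word; [|lia..].
rewrite prob_state_alternating; last lia.
by rewrite mulr_suml; apply: eq_bigr => k _; ring.
Qed.

End DerangementProcess.

Theorem lemma4 (R : realType) (p : nat -> R)
  (hp1 : p 1%N = 0) (hp2 : p 2%N = 1)
  (hp : forall i : nat, (3 <= i)%N -> 0 < p i < 1) :
  let q := compl_seq p in
  (forall (n j : nat), (1 < j <= n)%N ->
   forall (d : measure_display) (T : measurableType d) (P : probability T R)
     (X : nat -> {RV P >-> bool}),
     derangement_process p n X ->
     ('E_P[fun w => (cycle_count n j X w)%:R] =
      (q (n - j).+1 * \prod_((n - j).+2 <= l < n) p l
       + \sum_(j.+1 <= i < n) \sum_(0 <= k < n - i)
           (-1) ^+ k * q (i - j)%N * (\prod_((i - j).+1 <= l < i.-1) p l)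
             * \prod_(i <= l < (k + i).+1) q l)%:E)%E)
  /\
  ((exists2 alpha : R, 0 <= alpha &
      (fun n : nat => n%:R * q n) @ \oo --> alpha) ->
   forall (j m : nat), (1 < j)%N -> (1 <= m)%N ->
     (forall k : nat, cvgn (bar_b_seq p k j)) /\
     exists2 eps : R, eps <= bar_b p (2 * m) j &
       forall (d : nat -> measure_display)
         (T : forall n : nat, measurableType (d n))
         (P : forall n : nat, probability (T n) R)
         (X : forall n : nat, nat -> {RV (P n) >-> bool}),
         (forall n : nat, (2 <= n)%N -> derangement_process p n (X n)) ->
         (fun n : nat => 'E_(P n)[fun w => (cycle_count n j (X n) w)%:R]%E)
           @ \oo -->
         (\sum_(0 <= k < 2 * m) (-1) ^+ k * bar_b p k j + eps)%:E).
Proof.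
move=> q; have p_gt0 i : (2 <= i)%N -> 0 < p i.
  by rewrite leq_eqVlt => /orP[/eqP <-|/hp/andP[]//]; rewrite hp2.
have p_le1 i : (2 <= i)%N -> p i <= 1.
  by rewrite leq_eqVlt => /orP[/eqP <-|/hp/andP[_ /ltW]//]; rewrite hp2.
have p01 i : (0 < i)%N -> 0 <= p i <= 1.
  rewrite leq_eqVlt => /orP[/eqP <-|i2]; first by rewrite hp1 lexx ler01.
  by rewrite (ltW (p_gt0 _ i2)) p_le1.
have mean := expectation_derangement_cycle_count hp1 p_gt0 p_le1.
split=> [n j jn d T P X XP|[alpha _ q_cvg] j m j1 _].
  by apply: mean => //; lia.
have [M qM] : exists M, forall i, i%:R * q i <= M.
  have [M [_ qM]] := cvg_seq_bounded (cvgP _ q_cvg).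
  (* Boundedness is only provided for constants strictly above [M], whence [M + 1]. *)
  exists (M + 1) => i; apply: le_trans (ler_norm _) (qM _ _ i I).
  by rewrite ltrDl.
have j0 : (0 < j)%N by exact: ltnW.
split=> [k|]; first exact: cvgn_bar_b_seq qM _ _ _.
have cvgF := cvgn_alternating_bar_b_seq p01 qM j0.
have := limn_alternating_bar_b_seq_le p01 qM m j0.
set F := (X in limn X) in cvgF *; move=> limF.
(* [eps] is the exact remainder of the limit, so it is fixed before any process is chosen. *)
exists (limn F - \sum_(0 <= k < 2 * m) (-1) ^+ k * bar_b p k j).
  by rewrite lerBlDl.
move=> d T P X XP; rewrite addrC subrK.
have cvgE : (fun n => q (n - j).+1 * \prod_((n - j).+2 <= l < n) p l + F n)
    @ \oo --> limn F.
  rewrite -[limn F]add0r; apply: cvgD cvgF.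
  exact: (@cvg_first_cycle_weight _ _ p01 _ qM j).
have cvgE' : (fun n =>
    (q (n - j).+1 * \prod_((n - j).+2 <= l < n) p l + F n)%:E)
    @ \oo --> (limn F)%:E.
  by apply: cvg_EFin; [exact: nearW | exact: cvgE].
apply: cvg_trans cvgE'.
(* The formula for the mean requires [j <= n], so the two sequences agree only eventually. *)
apply: near_eq_cvg; near=> n.
have jn : (j <= n)%N by near: n; exact: nbhs_infty_ge.
rewrite /= mean ?j1 //; [|lia|exact/XP/(leq_trans j1)].
by rewrite alternating_bar_b_seq.
Unshelve. all: by end_near. Qed.
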